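(* Let $P$ be a finite poset and $\mathcal{IC}(P)$ the set of interval-closed sets of $P$. If $P$ is the disjoint union of two posets $P=P_1+P_2$, then $T(\mathcal{IC}(P))\cong T(\mathcal{IC}(P_1))\times T(\mathcal{IC}(P_2))$. Suppose now that $P$ is not the disjoint union of two nonempty posets. If $P$ contains an extremal-atomic element $m$, then $T(\mathcal{IC}(P))\cong T(\mathcal{IC}(P\setminus\{m\}))\times T(\mathcal{IC}(\{m\}))\cong T(\mathcal{IC}(P\setminus\{m\}))\times\mathfrak{S}_2$. (So, in particular, if $P$ has only two ranks, then $T(\mathcal{IC}(P))\cong(\mathfrak{S}_2)^{|P|}$.) If $P$ is strongly-extremal-atomic-free, then $\mathcal{IC}(P)$ is toggle-alternating.
   Context: An interval-closed set in a poset $P$ is a subset $I\subseteq P$ such that if $x,y\in I$ and $x\le y$, then every $z\in P$ with $x\le z\le y$ is in $I$. $\mathcal{IC}(P)\subseteq 2^P$ is the set of interval-closed sets, with ground set $P$. The disjoint union $P_1+P_2$ is the poset on the disjoint union of the ground sets in which elements of $P_1$ are incomparable to elements of $P_2$ and each $P_i$ keeps its order. Subsets of $P$ such as $P\setminus\{m\}$ and $\{m\}$ carry the induced order. ''$P$ has only two ranks'' means $P$ has a rank function (increasing by one along each covering relation) taking exactly two values. An element $m\in P$ is extremal-atomic if it is a maximal element that only covers minimal elements or a minimal element that is only covered by maximal elements. $P$ is strongly-extremal-atomic-free if there is an ordered list of elements $p_1,p_2,\ldots,p_n$ of $P$ such that, defining the induced subposets $P_0:=P$ and $P_i:=P_{i-1}\setminus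 p_i$: $P_n$ is a chain with at least three elements, $p_{i+1}$ is maximal or minimal in $P_i$ for each $0\le i\le n-1$, and each $P_i$ has connected Hasse diagram and no extremal-atomic element. For a finite set $E$ and $\mathcal{L}\subseteq 2^E$, the toggle of $e\in E$ is the map $t_e:\mathcal{L}\to\mathcal{L}$ with $t_e(X)=X\cup\{e\}$ if $e\notin X$ and $X\cup\{e\}\in\mathcal{L}$; $t_e(X)=X\setminus\{e\}$ if $e\in X$ and $X\setminus\{e\}\in\mathcal{L}$; and $t_e(X)=X$ otherwise. The toggle group $T(\mathcal{L})$ is the subgroup of the symmetric group $\mathfrak{S}_{\mathcal{L}}$ generated by $\{t_e\mid e\in E\}$. $\mathcal{L}$ is toggle-alternating if $T(\mathcal{L})$ contains the alternating group $A_{\mathcal{L}}$. *)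

(* Defs.v *)
From HB Require Import structures.
From mathcomp Require Import all_boot all_order all_fingroup.
From mathcomp Require Import alt.

Set Implicit Arguments.
Unset Strict Implicit.
Unset Printing Implicit Defensive.

Import Order.Theory GroupScope.

Section Toggle.

Variable T : finType.
Implicit Types (E X : {set T}) (L : {set {set T}}).

Definition toggle_set L (e : T) X : {set T} :=
  if e \notin X then (if e |: X \in L then e |: X else X)
  else (if X :\ e \in L then X :\ e else X).

Lemma toggle_set_in L e X : X \in L -> toggle_set L e X \in L.
Proof. by rewrite /toggle_set => XL; do 2 case: ifP. Qed.

Lemma toggle_setK L e X : X \in L -> toggle_set L e (toggle_set L e X) = X.
Proof.
rewrite /toggle_set => XL; case: (boolP (e \in X)) => [eX | eNX] /=.
  case: (boolP (X :\ e \in L)) => H /=; last by rewrite eX /= (negbTE H).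
  by rewrite !inE eqxx /= setD1K // XL.
case: (boolP (e |: X \in L)) => H /=; last by rewrite eNX (negbTE H).
by rewrite !inE eqxx /= setU1K // XL.
Qed.

Definition toggle_fun L e (X : {X : {set T} | X \in L}) : {X | X \in L} :=
  exist _ (toggle_set L e (val X)) (toggle_set_in e (valP X)).

Lemma toggle_funK L e : involutive (@toggle_fun L e).
Proof. by move=> X; apply: val_inj; apply: toggle_setK (valP X). Qed.

Definition toggle L e : {perm {X : {set T} | X \in L}} :=
  perm (inv_inj (@toggle_funK L e)).

(* The ground set E is a subset of an ambient finite type, so that L is
   meant to be a subset of powerset E. *)
Definition toggle_group E L : {group {perm {X : {set T} | X \in L}}} :=
  <<[set toggle L e | e in E]>>%G.

Definition toggle_alternating E L : bool :=
  'Alt_{X : {set T} | X \in L} \subset toggle_group E L.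

End Toggle.

(* A subset A of a poset P stands for the induced subposet on A; P itself is
   the subposet [set: P]. *)
Section Subposets.

Variables (d : Order.disp_t) (P : finPOrderType d).
Implicit Types (A B I : {set P}) (m x y z : P).

Local Open Scope order_scope.

Definition interval_closed A I : bool :=
  (I \subset A) &&
  [forall x in I, forall y in I, forall z in A, (x <= z <= y) ==> (z \in I)].

Definition IC A : {set {set P}} := [set I | interval_closed A I].

(* T(IC(A)), for the induced subposet A *)
Definition TIC A := toggle_group A (IC A).

(* x is covered by y *)
Definition covered A x y : bool :=
  [&& x \in A, y \in A, x < y & [forall z in A, ~~ (x < z < y)]].

Definition maximal A x : bool := (x \in A) && [forall y in A, ~~ (x < y)].

Definition minimal A x : bool := (x \in A) && [forall y in A, ~~ (y < x)].

Definition extremal_atomic A m : bool :=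
  (maximal A m && [forall x in A, covered A x m ==> minimal A x]) ||
  (minimal A m && [forall x in A, covered A m x ==> maximal A x]).

Definition is_disjoint_union A B : Prop :=
  [/\ A :|: B = [set: P], A :&: B = set0
    & {in A & B, forall x y, x >< y}].

Definition hasse_edge A : rel P := fun x y => covered A x y || covered A y x.

Definition hasse_connected A : Prop := {in A &, forall x y, connect (hasse_edge A) x y}.

Definition is_chain A : Prop := {in A &, forall x y, x >=< y}.

Definition removal (p : seq P) : {set P} :=
  foldl (fun A x => A :\ x) [set: P] p.

(* removal (take i p) is P_i; tnth p i, counted from 0, is p_{i+1}. *)
Definition strongly_extremal_atomic_free : Prop :=
  exists n (p : n.-tuple P),
    [/\ is_chain (removal p) /\ (3 <= #|removal p|)%N,
        forall i : 'I_n, let Pi := removal (take i p) in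
          maximal Pi (tnth p i) || minimal Pi (tnth p i)
      & forall i, (i <= n)%N -> let Pi := removal (take i p) in
          hasse_connected Pi /\ forall m, ~~ extremal_atomic Pi m].

Definition two_ranks : Prop :=
  exists rk : P -> nat,
    (forall x y, covered [set: P] x y -> rk y = (rk x).+1) /\
    size (undup (codom rk)) = 2.

End Subposets.

(* Main.v *)
(** Disjoint unions and extremal-atomic elements make IC(P) a product family, on
    which toggles act coordinatewise; with two ranks every subset is
    interval-closed, and the toggles act on the power set as translations by
    symmetric difference.

    For the alternating statement, remove a maximal or minimal element m that lies
    at the end of a chain of three elements.  The sets avoiding m form L0 = IC(P - m);
    removing m embeds the remaining sets in L0, properly since m is not
    extremal-atomic.  The toggles at the other elements preserve L0 and induce on it
    a group containing Alt(L0); as L0 is larger than its complement and Alt(L0) is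
    simple, they generate the copy of Alt(L0) fixing the complement pointwise.
    Conjugating this copy by the toggle at m yields the whole alternating group.
    Removing elements one by one ends at a chain with three elements, which has
    seven interval-closed sets and is treated by explicit 3-cycles. *)
Require Import Defs.
From mathcomp Require Import all_boot all_order all_fingroup pgroup abelian alt.

Import Order.Theory GroupScope.
Set Implicit Arguments.
Unset Strict Implicit.
Unset Printing Implicit Defensive.

(** * Even permutations supported on a subset *)

Section EvenOn.
Variables (T : finType) (G : {group {perm T}}).
Implicit Types (S : {set T}) (x y z w u v : T).

(** Products of two transpositions generate the even permutations, so this says that [G] contains
    the alternating group of [S], extended by the identity outside [S]. *)
Definition even_on S := forall x y z w, x \in S -> y \in S -> z \in S ->
  w \in S -> x != y -> z != w -> tperm x y * tperm z w \in G.

(* Writing t0 for (u v), the transpositions of the coset G t0 are closed under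
   (x y), (y z) |-> (x z), since (x y)(y z)(x y) = (x y) t0 . t0 (y z) . (x y). *)
Lemma even_on_base u v S :
  (forall x, x \in S -> x != u -> tperm u x * tperm u v \in G) -> even_on S.
Proof.
move=> uP.
have pP x y : x \in S -> y \in S -> x != y -> tperm x y * tperm u v \in G.
  move=> xS yS xy; have [xu|xu] := eqVneq x u.
    by rewrite xu in xy *; apply: uP; rewrite // eq_sym.
  have [yu|yu] := eqVneq y u; first by rewrite yu tpermC; apply: uP.
  have -> : tperm x y * tperm u v =
      tperm u x * tperm u v * (tperm u y * tperm u v)^-1 * (tperm u x * tperm u v).
    rewrite invMg !mulgA mulgK tpermV.
    congr (_ * _); rewrite -{1}(tpermV u x) -mulgA -conjgE tpermJ tpermL.
    by rewrite tpermD // eq_sym.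
  by apply: groupM (uP x xS xu); apply: groupM (uP x xS xu) _; rewrite groupV uP.
move=> x y z w xS yS zS wS xy zw.
have := groupM (pP x y xS yS xy) (groupVr (pP z w zS wS zw)).
by rewrite invMg mulgA mulgK tpermV.
Qed.

(** Two shared points suffice because [(u v)] can serve as the base transposition of [even_on_base]
    for both sets at once. *)
Lemma even_onU u v S S' : u != v -> u \in S :&: S' -> v \in S :&: S' ->
  even_on S -> even_on S' -> even_on (S :|: S').
Proof.
move=> uv /setIP[uS uS'] /setIP[vS vS'] eS eS'; apply: (@even_on_base u v).
by move=> x /setUP[] xS xu; [apply: eS | apply: eS']; rewrite // eq_sym.
Qed.

Lemma even_onJ g S : g \in G -> even_on S -> even_on (g @: S).
Proof.
move=> gG eS ? ? ? ? /imsetP[x xS ->] /imsetP[y yS ->] /imsetP[z zS ->].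
move=> /imsetP[w wS ->]; rewrite !(inj_eq perm_inj) => xy zw.
by rewrite -!tpermJ -conjMg memJ_norm ?(subsetP (normG G)) // eS.
Qed.

(** Taking [(x y)] as base, the only nontrivial product to obtain is [(x z)(x y)], which is the
    inverse of the 3-cycle [g]. *)
Lemma even_on_cycle3 g x y z : g \in G -> x != y -> y != z -> z != x ->
  g x = y -> g y = z -> g z = x -> (forall w, w \notin [set x; y; z] -> g w = w) ->
  even_on [set x; y; z].
Proof.
move=> gG xy yz zx gx gy gz gw; apply: (@even_on_base x y) => w.
rewrite !inE -orbA => /or3P[] /eqP-> ; rewrite ?eqxx //.
  by rewrite tperm2.
move=> _; suff -> : tperm x z * tperm x y = g^-1 by rewrite groupV.
apply: (mulgI g); rewrite mulgV; apply/permP => a; rewrite !permM perm1.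
have [->|ax] := eqVneq a x; first by rewrite gx (tpermD xy) 1?eq_sym // tpermR.
have [->|ay] := eqVneq a y; first by rewrite gy tpermR tpermL.
have [->|az] := eqVneq a z; first by rewrite gz tpermL tpermD // eq_sym.
by rewrite gw ?inE ?negb_or ?ax ?ay ?az // !tpermD // eq_sym.
Qed.

(** An even permutation is a product of an even number of transpositions, which the induction
    consumes two at a time. *)
Lemma Alt_even_on : even_on [set: T] -> 'Alt_T \subset G.
Proof.
move=> eT; apply/subsetP => s; rewrite Alt_even.
case: (prod_tpermP s) => ts -> dts; rewrite odd_perm_prod //.
have [n] := ubnP (size ts); elim: n ts dts => // n IH [|[x y] [|[z w] ts]] //=.
  by rewrite big_nil.
case/and3P=> xy zw dts; rewrite ltnS negbK => sz ev.
rewrite !big_cons mulgA groupM ?eT ?inE // IH //.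
by apply: leq_trans sz; rewrite ltnS ltnW.
Qed.
End EvenOn.

(** * Transport of permutations along an injection, and lifting of the alternating group *)

Section PermPush.
Variables (T0 T : finType) (f : T0 -> T).
Hypothesis f_inj : injective f.
Local Notation A := [set f x | x : T0].

Definition push_fun (h : {perm T0}) y :=
  if [pick x | f x == y] is Some x then f (h x) else y.

Lemma push_fun_in h x : push_fun h (f x) = f (h x).
Proof.
rewrite /push_fun; case: pickP => [z /eqP/f_inj-> // | /(_ x)].
by rewrite eqxx.
Qed.

Lemma push_fun_out h y : y \notin A -> push_fun h y = y.
Proof.
rewrite /push_fun => yA; case: pickP => // x /eqP fx.
by rewrite -fx imset_f in yA.
Qed.

Lemma push_subproof h : injective (push_fun h).
Proof.
apply: (can_inj (g := push_fun h^-1)) => y.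
have [/imsetP[x _ ->]|yA] := boolP (y \in A).
  by rewrite !push_fun_in permK.
by rewrite !push_fun_out.
Qed.

Definition push h : {perm T} := perm (@push_subproof h).

Lemma pushE h x : push h (f x) = f (h x).
Proof. by rewrite permE push_fun_in. Qed.

Lemma push_out h y : y \notin A -> push h y = y.
Proof. by rewrite permE; apply: push_fun_out. Qed.

Lemma push_on h : push h \in perm.Sym A.
Proof.
by rewrite inE; apply/subsetP => y; apply: contraR => /(push_out h)/eqP.
Qed.

Lemma pushM : {in [set: {perm T0}] &, {morph push : g h / g * h}}.
Proof.
move=> g h _ _; apply/permP => y; rewrite permM.
have [/imsetP[x _ ->]|yA] := boolP (y \in A); first by rewrite !pushE permM.
by rewrite !push_out.
Qed.
Canonical push_morphism := Morphism pushM.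

Lemma injm_push : 'injm push.
Proof.
apply/injmP => g h _ _ gh; apply/permP => x; apply: f_inj.
by rewrite -!pushE gh.
Qed.

Lemma push_tperm x y : push (tperm x y) = tperm (f x) (f y).
Proof.
apply/permP => z; have [/imsetP[w _ ->]|zA] := boolP (z \in A).
  by rewrite pushE inj_tperm.
by rewrite push_out // tpermD //; apply: contraNneq zA => <-; rewrite imset_f.
Qed.

(* The image of H in the permutations of the complement of A is too small for H
   to embed in it, so the pointwise stabiliser K of this complement is nontrivial;
   a copy of the simple group Alt_T0 normalises K, hence lies in K. *)
Lemma even_on_image (H : {group {perm T}}) :
  (4 < #|T0|)%N -> (#|T| < 2 * #|T0|)%N -> H \subset 'N(A | 'P) ->
  (forall h, h \in 'Alt_T0 -> exists2 g, g \in H & forall x, g (f x) = f (h x)) ->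
  even_on H A.
Proof.
move=> T0_gt4 ltT nHA altH.
have cardA : #|A| = #|T0| by rewrite card_imset.
pose K := 'C_H(~: A | 'P)%G; pose B := (push @* 'Alt_T0)%G.
have simB : gseries.simple B.
  have/gseries.isog_simple<- : 'Alt_T0 \isog B by rewrite sub_isog ?injm_push ?subsetT.
  exact: simple_Alt5.
have KA : K \subset perm.Sym A by rewrite SymE subsetIr.
have BA : B \subset perm.Sym A.
  by apply/subsetP => _ /morphimP[h _ _ ->]; apply: push_on.
have nHAC : H \subset 'N(~: A | 'P) by rewrite astabsC.
have nKH : H \subset 'N(K).
  by rewrite normsI ?normG // (subset_trans nHAC) // astab_norm.
have liftB b : b \in B -> exists2 g, g \in H & {in A, b =1 g}.
  case/morphimP=> h _ /altH[g gH gE] ->; exists g => // _ /imsetP[x _ ->] /=.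
  by rewrite pushE gE.
(* If [g] in [H] agrees with [b] on [A], then [b * g^-1] fixes [A] pointwise and commutes with [K],
   whose elements move only points of [A]. So [b] conjugates [K] as [g] does. *)
have nKB : B \subset 'N(K).
  apply/normsP => b /[dup] bB /liftB[g gH bg].
  rewrite -{2}(normsP nKH g gH) -[b](mulgKV g) conjsgM.
  congr (_ :^ g); apply/normP; apply: (subsetP (cent_sub _)); apply/centP => k kK.
  apply: (@perm_onC _ (~: A) A); last by rewrite disjoint_sym disjoints_subset setCK.
    apply/subsetP => y; rewrite !inE permM; apply: contra => yA.
    by rewrite bg // permK.
  by have:= subsetP KA k kK; rewrite inE.
have nKI : (K :&: B)%G <| B by rewrite /normal subsetIr normsI ?normG.
have [K1|KB] := (gseries.simpleP _ simB).2 _ nKI; last first.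
  have BH : B \subset H by rewrite -KB (subset_trans (subsetIl _ _)) ?subsetIl.
  move=> _ _ _ _ /imsetP[x _ ->] /imsetP[y _ ->] /imsetP[z _ ->] /imsetP[w _ ->].
  rewrite !(inj_eq f_inj) => xy zw; apply: (subsetP BH).
  rewrite -!push_tperm -pushM ?inE //; apply: mem_morphim; first by rewrite inE.
  by rewrite Alt_even odd_permM !odd_tperm xy zw.
(* The remaining case, [K] meeting [B] trivially, is refuted by counting. [K * B] lies in the
   symmetric group of [A], so [K] has order at most 2. [B] lies in the restriction of [H] to [A],
   and [H / K] embeds in the permutations of the complement, which has at most n points when [T0]
   has n + 1. Hence (n + 1)! <= 4 n!, against [4 < #|T0|]. *)
have T0_gt1 : (1 < #|T0|)%N by apply: leq_trans T0_gt4.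
have cardB : (2 * #|B| = #|T0|`!)%N.
  by rewrite card_injm ?injm_push ?subsetT // card_Alt.
have leK : (#|K| <= 2)%N.
  rewrite -(leq_pmul2r (cardG_gt0 B)) -TI_cardMg // cardB -cardA -perm.card_Sym.
  by rewrite subset_leq_card // mul_subG.
have leB : (#|B| <= #|H|)%N.
  apply: leq_trans (leq_morphim (restr_perm_morphism A) H).
  apply: subset_leq_card; apply/subsetP => b /[dup] bB /liftB[g gH bg].
  have gN := subsetP nHA g gH.
  suff -> : b = restr_perm A g by rewrite mem_morphim.
  apply/permP => y; have [yA|yA] := boolP (y \in A).
    by rewrite restr_permE // bg.
  have:= subsetP BA b bB; rewrite inE => /out_perm-> //.
  by rewrite (out_perm (restr_perm_on A g)).
have indexH : (#|H : K| <= #|~: A|`!)%N.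
  have -> : #|H : K| = #|restr_perm (~: A) @* H|.
    by rewrite card_morphim ker_restr_perm (setIidPr nHAC) indexgI.
  rewrite -perm.card_Sym; apply/subset_leq_card/subsetP => _ /morphimP[g _ _ ->].
  by rewrite inE restr_perm_on.
have leH : (#|H| <= 2 * #|~: A|`!)%N.
  by rewrite -(Lagrange (subsetIl H 'C(~: A | 'P))) leq_mul.
have [n nE] : {n | #|T0| = n.+1} by exists #|T0|.-1; rewrite prednK // ltnW.
have : (n.+1`! <= 4 * n`!)%N.
  rewrite -nE -cardB (leq_trans (n := 2 * (2 * #|~: A|`!))) //.
    by rewrite leq_mul2l (leq_trans leB).
  rewrite mulnA leq_mul2l /= leq_fact // cardsCs setCK cardA nE.
  by rewrite leq_subLR addSn -ltnS -addSn -addnS -nE addnn -mul2n.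
by rewrite factS leq_pmul2r ?fact_gt0 // leqNgt -nE T0_gt4.
Qed.
End PermPush.

(** * From the alternating group of a subset to the whole alternating group *)

Lemma even_on_sub (T : finType) (H G : {group {perm T}}) S :
  H \subset G -> even_on H S -> even_on G S.
Proof. by move=> /subsetP sHG eS x y z w *; apply/sHG/eS. Qed.

(** Each [y] outside [A] is reached by a conjugate [g] of a 3-cycle of [A] under [t]: [g] sends [b]
    to [y] and fixes [u] and [v], whose [t]-images the 3-cycle does not move. Thus [A] and [g @: A]
    share [u] and [v], and [even_onU] joins them. *)
Lemma Alt_even_on_involution (T : finType) (G : {group {perm T}}) (A : {set T})
    (t : {perm T}) b u v :
  even_on G A -> t \in G -> involutive t -> (forall y, y \notin A -> t y \in A) ->
  b \in A -> t b = b -> u \in A -> v \in A -> u != v -> t u \notin A ->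
  t v \notin A -> 'Alt_T \subset G.
Proof.
move=> eA tG tK tA bA tb uA vA uv tuA tvA; apply: Alt_even_on.
apply: (@even_on_base _ _ u v) => y _ yu.
have [yA|yA] := boolP (y \in A); first by apply: eA; rewrite // eq_sym.
pose k := t y; have kA : k \in A by apply: tA.
have bN w : t w \notin A -> b != w by apply: contraNneq => <-; rewrite tb.
have bk : b != k by apply: bN; rewrite tK.
(* The third point of the 3-cycle on [b], [k], [w]: whichever of [u] and [v] differs from [k].
   Neither equals [b], which [t] keeps in [A]. *)
have [w [wA wb wk]] : exists w, [/\ w \in A, b != w & w != k].
  have [ku|ku] := eqVneq k u; first by exists v; rewrite ku bN // eq_sym.
  by exists u; rewrite bN // eq_sym.
pose h := tperm b k * tperm b w.
have hG : h \in G by apply: eA.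
have hout x : x \notin A -> h x = x.
  move=> xA; have xP z : z \in A -> z != x by move=> zA; apply: contraNneq xA => <-.
  by rewrite permM (tpermD (x := b) (y := k)) ?tpermD ?xP.
have hb : h b = k by rewrite permM tpermL tpermD.
pose g := t * h * t; have gG : g \in G by do 2?apply: groupM.
have gfix x : t x \notin A -> g x = x by move=> txA; rewrite 2!permM hout // tK.
have gb : g b = y by rewrite 2!permM tb hb tK.
have fixA x : x \in A -> t x \notin A -> x \in A :&: g @: A.
  by move=> xA /gfix gx; rewrite inE xA -{1}gx imset_f.
apply: (even_onU uv _ _ eA (even_onJ gG eA)); rewrite ?fixA ?inE ?uA ?vA //.
- by rewrite -gb imset_f ?orbT.
- by rewrite eq_sym.
Qed.

(** The involution is the toggle at [m], and [A] is the copy of [L0] in [L]. The set [X0] is its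
    fixed point in [A], while [X1] and [X2] are the two points that it moves out of [A]. *)
Lemma toggle_alternating_step (T : finType) (E : {set T}) (L : {set {set T}}) m
    (L0 := [set X in L | m \notin X]) X0 X1 X2 :
  m \in E -> (forall X, X \in L -> X :\ m \in L) ->
  X0 \in L0 -> m |: X0 \notin L ->
  X1 \in L0 -> m |: X1 \in L -> X2 \in L0 -> m |: X2 \in L -> X1 != X2 ->
  (4 < #|L0|)%N -> toggle_alternating (E :\ m) L0 -> toggle_alternating E L.
Proof.
move=> mE Lm X0L mX0 X1L mX1 X2L mX2 X12 L0_gt4 altL0.
have L0L : L0 \subset L by apply/subsetP => X; rewrite inE => /andP[].
pose f (X : {X | X \in L0}) : {X | X \in L} := exist _ (val X) (subsetP L0L _ (valP X)).
have f_inj : injective f by move=> X Y [XY]; apply: val_inj.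
pose A := [set f X | X : {X | X \in L0}].
have AE (X : {X | X \in L}) : (X \in A) = (m \notin val X).
  apply/imsetP/idP => [[Y _ ->]|mX]; first by have := valP Y; rewrite inE => /andP[].
  have XL0 : val X \in L0 by rewrite inE (valP X).
  by exists (exist _ (val X) XL0) => //; apply: val_inj.
pose H := toggle_group (E :\ m) L.
have sHG : H \subset toggle_group E L.
  by rewrite genS // imsetS // subD1set.
have togH e : e \in E :\ m -> toggle L e \in H by move=> eE; rewrite mem_gen // imset_f.
have mem_toggle e (X : {set T}) : e != m -> (m \in toggle_set L e X) = (m \in X).
  rewrite /toggle_set => em; do 2 case: ifP => //.
    by rewrite !inE eq_sym (negPf em).
  by rewrite !inE eq_sym em.
have nHA : H \subset 'N(A | 'P).
  rewrite gen_subG; apply/subsetP => _ /imsetP[e /setD1P[em _] ->].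
  rewrite !inE; apply/subsetP => X; rewrite inE /= !AE /aperm permE /=.
  by rewrite mem_toggle.
have liftH h : h \in 'Alt_{X | X \in L0} ->
    exists2 g, g \in H & forall x, g (f x) = f (h x).
  (* The permutations of [L0] that lift to [H] form a group, so it is enough to lift the generating
     toggles. *)
  move=> /(subsetP altL0); pose W :=
    [set h : {perm {X | X \in L0}} | [exists g in H, [forall x, g (f x) == f (h x)]]].
  have gW : group_set W.
    apply/group_setP; split=> [|h1 h2].
      rewrite inE; apply/existsP; exists 1; rewrite group1.
      by apply/forallP => x; rewrite !perm1.
    rewrite !inE => /exists_inP[g1 g1H /forallP h1E] /exists_inP[g2 g2H /forallP h2E].
    apply/exists_inP; exists (g1 * g2); first exact: groupM.
    by apply/forallP => x; rewrite !permM (eqP (h1E _)) h2E.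
  move=> hL0; suff : h \in Group gW.
    by rewrite inE => /exists_inP[g gH /forallP gE]; exists g => // x; apply/eqP.
  apply: subsetP hL0; rewrite gen_subG; apply/subsetP => _ /imsetP[e eE ->].
  rewrite inE; apply/exists_inP; exists (toggle L e); first exact: togH.
  apply/forallP => -[X XL0]; rewrite !permE; apply/eqP/val_inj => /=.
  have [em _] := setD1P eE; have [_ mX] := setIdP XL0.
  by rewrite /toggle_set !inE ![m == e]eq_sym (negPf em) (negPf mX) !andbT.
pose t := toggle L m.
have tK : involutive t by move=> X; rewrite !permE; apply: toggle_funK.
have tA X : X \notin A -> t X \in A.
  rewrite !AE negbK permE /= /toggle_set => mX.
  by rewrite mX /= Lm ?(valP X) // !inE eqxx.
pose in0 X (XL : X \in L0) := f (exist _ X XL).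
have tin X (XL : X \in L0) : m |: X \in L -> t (in0 X XL) \notin A.
  move=> mXL; have := XL; rewrite inE AE permE /= /toggle_set => /andP[_ mX].
  by rewrite mX mXL !inE eqxx.
have x0A : in0 X0 X0L \in A by apply: imset_f.
have tx0 : t (in0 X0 X0L) = in0 X0 X0L.
  apply: val_inj; have := X0L; rewrite inE permE /= /toggle_set => /andP[_ mX].
  by rewrite mX (negPf mX0).
have cardL0 : #|{: {X | X \in L0}}| = #|L0| by rewrite card_sig.
have eA : even_on (toggle_group E L) A.
  apply: even_on_sub sHG _; apply: (even_on_image f_inj) nHA liftH.
    by rewrite cardL0.
  have cA : #|A| = #|{: {X | X \in L0}}| by rewrite card_imset.
  (* The toggle at [m] injects the complement into [A], and its fixed point [X0] is not attained. *)
  have : (#|~: A| < #|A|)%N.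
    rewrite (cardsD1 (in0 X0 X0L) A) x0A ltnS -(card_imset (~: A) (@perm_inj _ t)).
    apply/subset_leq_card/subsetP => _ /imsetP[X XA ->]; rewrite inE in XA.
    rewrite !inE tA // andbT; apply: contraNneq XA => tX.
    by rewrite -[X]tK tX tx0.
  by rewrite cardsCs setCK ltn_subLR ?max_card // cA addnn mul2n.
apply: (Alt_even_on_involution (t := t) eA _ tK tA x0A tx0
  (imset_f _ _) (imset_f _ _) _ (tin X1 X1L mX1) (tin X2 X2L mX2)) => //.
by rewrite mem_gen // imset_f.
Qed.

(** * Adding back a maximal or minimal element *)

Section IntervalClosed.
Variables (d : Order.disp_t) (P : finPOrderType d).
Implicit Types (A I X : {set P}) (m x y z : P).
Local Open Scope order_scope.

(* Interval-closure is self-dual: r is allowed to be the order or its converse,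
   so that minimal elements need no separate treatment. *)
Lemma ICP (r : rel P) A I : r = <=%O \/ r = >=%O ->
  reflect (I \subset A /\
           forall x y z, x \in I -> y \in I -> z \in A -> r x z -> r z y -> z \in I)
    (I \in IC A).
Proof.
move=> rE; rewrite inE; apply: (iffP andP) => -[sIA closedI]; split=> //.
  move=> x y z xI yI zA; case: rE => -> xz zy.
    move/forall_inP/(_ x xI)/forall_inP/(_ y yI)/forall_inP/(_ z zA): closedI.
    by rewrite xz zy.
  move/forall_inP/(_ y yI)/forall_inP/(_ x xI)/forall_inP/(_ z zA): closedI.
  by move: xz zy => /= -> ->.
apply/forall_inP => x xI; apply/forall_inP => y yI; apply/forall_inP => z zA.
apply/implyP => /andP[xz zy].
by case: rE closedI => -> closedI; [apply: (closedI x y) | apply: (closedI y x)].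
Qed.

(** An [r]-extremal [m] never lies strictly inside an interval, so its presence in the ground set
    puts no condition on sets avoiding it, and deleting it creates no gap. *)
Lemma IC_removal (r : rel P) A m : r = <=%O \/ r = >=%O ->
  m \in A -> {in A, forall y, r m y -> y = m} ->
  [set X in IC A | m \notin X] = IC (A :\ m) /\
  forall X, X \in IC A -> X :\ m \in IC A.
Proof.
move=> rE mA mP; split=> [|X].
  apply/setP => X; rewrite inE; apply/andP/idP => [[/(ICP _ _ rE)[sXA cX] mX]|].
    apply/(ICP _ _ rE); rewrite subsetD1 sXA; split=> // x y z xX yX.
    by rewrite !inE => /andP[_]; apply: cX.
  move=> /(ICP _ _ rE)[]; rewrite subsetD1 => /andP[sXA mX] cX; split=> //.
  apply/(ICP _ _ rE); split=> // x y z xX yX zA xz zy.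
  have [zm|zm] := eqVneq z m; last by apply: (cX x y); rewrite // !inE zm.
  by rewrite zm -(mP y) ?(subsetP sXA) // -zm.
move=> /(ICP _ _ rE)[sXA cX]; apply/(ICP _ _ rE); split.
  exact: subset_trans (subD1set _ _) sXA.
move=> x y z /setD1P[xm xX] /setD1P[ym yX] zA xz zy.
rewrite !inE (cX x y) // andbT; apply: contraNneq ym => zm.
by rewrite (mP y) ?(subsetP sXA) // -zm.
Qed.

(** The size bound is carried through the induction because the next step uses the simplicity of the
    alternating group of [IC A]. *)
Definition large_alternating A :=
  (4 < #|IC A|)%N /\ toggle_alternating A (IC A).

Lemma large_alternating_step (r : rel P) A m x y : r = <=%O \/ r = >=%O ->
  m \in A -> {in A, forall z, r m z -> z = m} ->
  x \in A -> y \in A -> x != y -> y != m -> r x y -> r y m ->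
  large_alternating (A :\ m) -> large_alternating A.
Proof.
move=> rE mA mP xA yA xy ym rxy rym [cardI altI].
have [ICE ICm] := IC_removal rE mA mP; rewrite -ICE in cardI altI.
have r_refl : reflexive r by case: rE => ->; apply: lexx.
have r_trans u v w : r u v -> r v w -> r u w.
  by case: rE => ->; [apply: le_trans | move=> uv vw; apply: le_trans uv].
have r_anti u v : r u v -> r v u -> u = v.
  by case: rE => -> uv vu; apply/le_anti/andP.
have xm : x != m by apply: contraNneq xy => xm; apply/eqP/r_anti; rewrite // xm.
split.
  by apply: leq_trans cardI (subset_leq_card _); apply/subsetP => X /setIdP[].
pose X2 := [set z in A | r z m && (z != m)].
have X2A : X2 \subset A by apply/subsetP => z; rewrite inE => /andP[].
(* For the three-chain [x], [y], [m]: adding [m] to the singleton of [x] leaves the gap [y], whereas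
   adding [m] to the empty set, or to the set [X2] of all elements strictly on the [r]-side of [m],
   keeps it closed. [X2] is nonempty since it contains [x]. *)
apply: (toggle_alternating_step (X0 := [set x]) (X1 := set0) (X2 := X2)
  mA ICm) cardI altI.
- rewrite !inE eq_sym xm andbT -in_set -/(IC A); apply/(ICP _ _ rE).
  rewrite sub1set; split=> // u v z /set1P-> /set1P-> _ xz zx.
  by rewrite inE (r_anti _ _ xz zx).
- apply: contra xy => /(ICP _ _ rE)[_ cX].
  have := cX x m y (setU1r _ (set11 x)) (setU11 _ _) yA rxy rym.
  by rewrite !inE (negPf ym) eq_sym.
- rewrite inE in_set0 andbT; apply/(ICP _ _ rE); rewrite sub0set; split=> // u v z.
  by rewrite inE.
- rewrite setU0; apply/(ICP _ _ rE); rewrite sub1set; split=> // u v z.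
  by move=> /set1P-> _ zA mz _; rewrite inE (mP z).
- rewrite inE [m \in X2]inE eqxx !andbF andbT; apply/(ICP _ _ rE); split=> //.
  move=> u v z _ /[!inE]/and3P[vA vm vNm] zA _ zv; rewrite zA (r_trans _ v) //=.
  by apply: contraNneq vNm => zm; rewrite (mP v) // -zm.
- apply/(ICP _ _ rE); split; first by rewrite subUset sub1set mA.
  move=> u v z _ vX zA _ zv; rewrite !inE zA; case: eqP => //= _.
  by rewrite andbT (r_trans _ v) //; case/setU1P: vX => [->|/[!inE]/and3P[]].
- rewrite eq_sym; apply/set0Pn; exists x; rewrite inE xA xm andbT.
  exact: r_trans rym.
Qed.

Lemma maximalE A m : maximal A m -> m \in A /\ {in A, forall z, m <= z -> z = m}.
Proof.
move=> /andP[mA /forall_inP mP]; split=> // z zA mz; apply/eqP.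
by have := mP z zA; rewrite lt_neqAle mz andbT negbK eq_sym.
Qed.

Lemma minimalE A m : minimal A m -> m \in A /\ {in A, forall z, z <= m -> z = m}.
Proof.
move=> /andP[mA /forall_inP mP]; split=> // z zA zm; apply/eqP.
by have := mP z zA; rewrite lt_neqAle zm andbT negbK.
Qed.

(** Failure of extremal-atomicity supplies the three-chain: a maximal [m] covers some non-minimal
    [y], which has an [x] below it. The minimal case is the same for the converse order. *)
Lemma extremal_step A m : maximal A m || minimal A m -> ~~ extremal_atomic A m ->
  large_alternating (A :\ m) -> large_alternating A.
Proof.
move=> mA; rewrite negb_or => /andP[].
case/orP: mA => /[dup] mmA -> /= => [+ _|_].
  move=> /forall_inPn[y yA].
  rewrite negb_imply => /andP[/and4P[_ mA ym _]].
  rewrite negb_and yA /= => /forall_inPn[x xA /negPn xy].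
  have [_ mP] := maximalE mmA.
  by apply: (large_alternating_step (r := <=%O) _ mA mP xA yA);
     rewrite ?lt_eqF ?ltW //; left.
move=> /forall_inPn[y yA].
rewrite negb_imply => /andP[/and4P[mA _ my _]].
rewrite negb_and yA /= => /forall_inPn[x xA /negPn yx].
have [_ mP] := minimalE mmA.
by apply: (large_alternating_step (r := >=%O) _ mA mP xA yA);
   rewrite ?gt_eqF //= ?ltW //; right.
Qed.
End IntervalClosed.

(** * The three-element chain *)

(* The subset {a | x} + {b | y} + {c | z} of the chain a < b < c is encoded by the
   triple (x, y, z). *)
Notation bits := (bool * bool * bool)%type.

(** The only subset of the chain that is not interval-closed is {a, c}. *)
Definition bits_ok (t : bits) := ~~ [&& t.1.1, t.2 & ~~ t.1.2].

Definition bits_toggle (f : bits -> bits) t := if bits_ok (f t) then f t else t.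

Definition flip_a (t : bits) : bits := (~~ t.1.1, t.1.2, t.2).
Definition flip_b (t : bits) : bits := (t.1.1, ~~ t.1.2, t.2).
Definition flip_c (t : bits) : bits := (t.1.1, t.1.2, ~~ t.2).

(** Two 3-cycles and their conjugates by toggles give alternating groups on triples, which are glued
    along pairs of common points until all seven sets are covered. *)
Lemma Alt_bits_toggle (S : finType) (G : {group {perm S}}) (el : bits -> S)
    (ta tb tc : {perm S}) :
  ta \in G -> tb \in G -> tc \in G ->
  (forall s, exists2 t, bits_ok t & s = el t) ->
  (forall t u, bits_ok t -> bits_ok u -> (el t == el u) = (t == u)) ->
  (forall t, bits_ok t -> ta (el t) = el (bits_toggle flip_a t)) ->
  (forall t, bits_ok t -> tb (el t) = el (bits_toggle flip_b t)) ->
  (forall t, bits_ok t -> tc (el t) = el (bits_toggle flip_c t)) ->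
  (4 < #|S|)%N /\ 'Alt_S \subset G.
Proof.
move=> taG tbG tcG elP el_eq taE tbE tcE.
split.
  pose ts := [:: (false, false, false); (true, false, false); (false, true, false);
    (false, false, true); (true, true, false)].
  have /card_uniqP cs : uniq (map el ts) by rewrite /= !inE !el_eq.
  by apply: leq_trans (max_card (mem (map el ts))); rewrite cs size_map.
pose e0 := el (false, false, false); pose e1 := el (true, false, false).
pose e2 := el (false, true, false); pose e3 := el (false, false, true).
pose e4 := el (true, true, false); pose e5 := el (false, true, true).
pose e6 := el (true, true, true).
have neq02 : e0 != e2 by rewrite el_eq.
(* [ta * tb] permutes the three sets containing c in a 3-cycle and has order 2 on the four sets
   avoiding c, so its square is a 3-cycle. The next block does the same with a and c exchanged. *)
have S356 : even_on G [set e5; e3; e6].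
  apply: (@even_on_cycle3 _ _ (ta * tb * (ta * tb))); rewrite ?el_eq //.
  - by do ![apply: groupM].
  - by rewrite !permM taE // tbE // taE // tbE.
  - by rewrite !permM taE // tbE // taE // tbE.
  - by rewrite !permM taE // tbE // taE // tbE.
  move=> w; have [t t_ok ->] := elP w; rewrite !inE !el_eq // !permM.
  by case: t t_ok => [[[] []] []] // _ _; rewrite taE // tbE // taE // tbE.
have S146 : even_on G [set e4; e1; e6].
  apply: (@even_on_cycle3 _ _ (tc * tb * (tc * tb))); rewrite ?el_eq //.
  - by do ![apply: groupM].
  - by rewrite !permM tcE // tbE // tcE // tbE.
  - by rewrite !permM tcE // tbE // tcE // tbE.
  - by rewrite !permM tcE // tbE // tcE // tbE.
  move=> w; have [t t_ok ->] := elP w; rewrite !inE !el_eq // !permM.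
  by case: t t_ok => [[[] []] []] // _ _; rewrite tcE // tbE // tcE // tbE.
have S024 : even_on G [set e2; e0; e4].
  by have := even_onJ tcG S356; rewrite !imsetU !imset_set1 !tcE.
have S025 : even_on G [set e2; e0; e5].
  by have := even_onJ taG S146; rewrite !imsetU !imset_set1 !taE.
have S0245 : even_on G ([set e2; e0; e4] :|: [set e2; e0; e5]).
  by apply: (even_onU neq02 _ _ S024 S025); rewrite !inE eqxx ?orbT.
have S0213 : even_on G ([set e0; e2; e1] :|: [set e0; e2; e3]).
  by have := even_onJ tbG S0245; rewrite !imsetU !imset_set1 !tbE.
have S012345 : even_on G (([set e2; e0; e4] :|: [set e2; e0; e5])
    :|: ([set e0; e2; e1] :|: [set e0; e2; e3])).
  by apply: (even_onU neq02 _ _ S0245 S0213); rewrite !inE eqxx ?orbT.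
have neq35 : e3 != e5 by rewrite el_eq.
have {}S012345 := even_onU neq35 _ _ S012345 S356.
apply/Alt_even_on/(eq_ind _ (even_on G) (S012345 _ _)); rewrite ?inE ?eqxx ?orbT //.
apply/setP => w; have [t t_ok ->] := elP w.
by case: t t_ok => [[[] []] []] // _; rewrite !inE eqxx ?orbT.
Qed.

Section ThreeChain.
Variables (d : Order.disp_t) (P : finPOrderType d) (a b c : P).
Hypotheses (ab : (a < b)%O) (bc : (b < c)%O).
Local Notation A := [set a; b; c].

Let ac : (a < c)%O. Proof. exact: lt_trans bc. Qed.
Let neqs : ((a == b) = false) * ((b == a) = false) * ((a == c) = false)
  * ((c == a) = false) * ((b == c) = false) * ((c == b) = false).
Proof.
by rewrite !(lt_eqF ab, gt_eqF ab, lt_eqF ac, gt_eqF ac, lt_eqF bc, gt_eqF bc).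
Qed.

Definition bits_set (t : bits) : {set P} :=
  [set x | [|| (x == a) && t.1.1, (x == b) && t.1.2 | (x == c) && t.2]].

Definition set_bits (X : {set P}) : bits := (a \in X, b \in X, c \in X).

Lemma bits_setK : cancel bits_set set_bits.
Proof.
by move=> [[x y] z]; rewrite /set_bits !inE !neqs !eqxx /= !orbF.
Qed.

Lemma IC_bits X : X \in IC A -> bits_ok (set_bits X) /\ bits_set (set_bits X) = X.
Proof.
case/(ICP _ _ (or_introl erefl)) => sXA cX; split.
  apply/and3P => -[aX cX' /negP]; apply; apply: (cX a c) => //; rewrite ?ltW //.
  by rewrite !inE eqxx orbT.
apply/setP => x; rewrite inE /=; apply/idP/idP => [/or3P[] /andP[/eqP->] // |xX].
by move: (subsetP sXA x xX); rewrite !inE -orbA => /or3P[] /eqP xE;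
   rewrite -!xE xX eqxx ?orbT.
Qed.

Lemma bits_IC t : bits_ok t -> bits_set t \in IC A.
Proof.
move=> t_ok; apply/(ICP _ _ (or_introl erefl)); split.
  apply/subsetP => x; rewrite !inE -orbA.
  by case/or3P => /andP[-> _]; rewrite ?orbT.
move=> x y z; rewrite !inE -!orbA => /or3P[]/andP[/eqP-> tx];
  move=> /or3P[]/andP[/eqP-> ty] /or3P[]/eqP->;
  rewrite ?lexx ?(lt_geF ab) ?(lt_geF ac) ?(lt_geF bc) ?neqs ?eqxx ?tx ?ty ?orbT //=.
by move: t_ok; rewrite /bits_ok tx ty !orbF => /negPn.
Qed.

Lemma mem_IC_bits t : (bits_set t \in IC A) = bits_ok t.
Proof.
by apply/idP/idP => [/IC_bits[]|/bits_IC //]; rewrite bits_setK.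
Qed.

Let Omega := {X : {set P} | X \in IC A}.
(** The empty set is the value of [el] at the one excluded triple; the facts about [el] are stated
    for triples satisfying [bits_ok]. *)
Let dflt : Omega := exist (fun X : {set P} => X \in IC A) _
  (bits_IC (t := (false, false, false)) isT).
Let el (t : bits) : Omega := insubd dflt (bits_set t).

Let val_el t : bits_ok t -> val (el t) = bits_set t.
Proof. by move=> t_ok; rewrite insubdK // bits_IC. Qed.

Let elP (X : Omega) : exists2 t, bits_ok t & X = el t.
Proof.
have [t_ok tX] := IC_bits (valP X); exists (set_bits (val X)) => //.
by apply: val_inj; rewrite val_el.
Qed.

Let el_eq t u : bits_ok t -> bits_ok u -> (el t == el u) = (t == u).
Proof.
move=> t_ok u_ok; rewrite -val_eqE /= !val_el //.
exact: (inj_eq (can_inj bits_setK)).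
Qed.

Let toggle_el e f t :
  bits_set (f t) = (if e \in bits_set t then bits_set t :\ e else e |: bits_set t) ->
  bits_ok t -> toggle (IC A) e (el t) = el (bits_toggle f t).
Proof.
move=> fE t_ok; apply: val_inj.
rewrite permE /= val_el // /toggle_set /bits_toggle -!mem_IC_bits.
move: fE; case: (boolP (e \in bits_set t)) => _ fE; rewrite -fE /=.
  by case: ifP => ft; rewrite val_el // -mem_IC_bits.
by case: ifP => ft; rewrite val_el // -mem_IC_bits.
Qed.

Let taE t : bits_ok t ->
  toggle (IC A) a (el t) = el (bits_toggle flip_a t).
Proof.
apply: toggle_el; case: t => [[x y] z]; rewrite inE /= !neqs eqxx /= orbF.
by case: x;
  apply/setP => w; rewrite !inE; have [->|] := eqVneq w a; rewrite ?neqs ?andbF.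
Qed.
Let tbE t : bits_ok t ->
  toggle (IC A) b (el t) = el (bits_toggle flip_b t).
Proof.
apply: toggle_el; case: t => [[x y] z]; rewrite inE /= !neqs eqxx /= orbF.
by case: y;
  apply/setP => w; rewrite !inE; have [->|] := eqVneq w b; rewrite ?neqs ?andbF ?orbF.
Qed.
Let tcE t : bits_ok t ->
  toggle (IC A) c (el t) = el (bits_toggle flip_c t).
Proof.
apply: toggle_el; case: t => [[x y] z]; rewrite inE /= !neqs eqxx /=.
by case: z;
  apply/setP => w; rewrite !inE; have [->|] := eqVneq w c; rewrite ?neqs ?andbF ?orbF ?orbT.
Qed.

Lemma large_alternating_chain3 : large_alternating A.
Proof.
rewrite /large_alternating -[#|IC A|]card_sig.
apply: (Alt_bits_toggle _ _ _ elP el_eq taE tbE tcE).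
- by rewrite mem_gen // imset_f // !inE eqxx.
- by rewrite mem_gen // imset_f // !inE eqxx orbT.
- by rewrite mem_gen // imset_f // !inE eqxx orbT.
Qed.
End ThreeChain.

(** * Chains, and the induction over a removal sequence *)

Section Chains.
Variables (d : Order.disp_t) (P : finPOrderType d).
Local Open Scope order_scope.

(** The least element is peeled off under the converse order; with the next two elements it forms
    the required three-chain. The induction stops at three elements. *)
Lemma large_alternating_sorted (s : seq P) :
  sorted <%O s -> (2 < size s)%N -> large_alternating [set x in s].
Proof.
elim: s => [//|a [//|b [//|c [|e s]]]] IH.
  move=> /=/and3P[ab bc _] _; have -> : [set x in [:: a; b; c]] = [set a; b; c].
    by apply/setP => x; rewrite !inE orbA.
  exact: large_alternating_chain3.
set s' := [:: b, c, e & s] => sorted_s _.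
have ltas : all (> a) s' by apply: order_path_min sorted_s => //; apply: lt_trans.
have aNs : a \notin s' by apply/negP => /(allP ltas)/=; rewrite ltxx.
have /= /and3P[ab bc _] := sorted_s.
have ss' : sorted <%O s' by apply: path_sorted sorted_s.
apply: (large_alternating_step (r := >=%O) (m := a) (y := b) (x := c)).
- by right.
- by rewrite !inE eqxx.
- move=> z; rewrite inE => /predU1P[//|/(allP ltas)/=] az /=.
  by move=> /(lt_le_trans az); rewrite ltxx.
- by rewrite !inE eqxx !orbT.
- by rewrite !inE eqxx !orbT.
- by rewrite gt_eqF.
- by rewrite gt_eqF.
- exact: ltW.
- exact: ltW.
suff -> : [set x in a :: s'] :\ a = [set x in s'] by apply: IH.
apply/setP => x; rewrite !inE; have [->|//] := eqVneq x a.
by move: aNs; rewrite !inE => /negPf.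
Qed.

Lemma large_alternating_chain (A : {set P}) :
  is_chain A -> (2 < #|A|)%N -> large_alternating A.
Proof.
move=> chainA A_gt2; pose s := sort <=%O (enum A).
have -> : A = [set x in s] by apply/setP => x; rewrite inE mem_sort mem_enum.
apply: large_alternating_sorted; last by rewrite size_sort -cardE.
rewrite lt_sorted_uniq_le sort_uniq enum_uniq /=.
apply: (sort_sorted_in (P := mem A)); last by apply/allP => x; rewrite mem_enum.
exact: chainA.
Qed.

Lemma removal_take n (p : n.-tuple P) (i : 'I_n) :
  removal (take i.+1 p) = removal (take i p) :\ tnth p i.
Proof.
rewrite (take_nth (tnth p i)) ?size_tuple // /removal foldl_rcons.
by rewrite -tnth_nth.
Qed.

Lemma large_alternating_strongly_extremal_atomic_free :
  strongly_extremal_atomic_free P -> large_alternating [set: P].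
Proof.
move=> [n [p [[chainP ge3] extP freeP]]].
(* Here [k] counts the elements put back, starting from the final chain. *)
suff H k : (k <= n)%N -> large_alternating (removal (take (n - k) p)).
  by have := H n (leqnn n); rewrite subnn take0.
elim: k => [_|k IH ltkn].
  by rewrite subn0 take_oversize ?size_tuple //; apply: large_alternating_chain.
have lti : (n - k.+1 < n)%N by rewrite ltn_subrL (leq_trans _ ltkn).
have [_ nEA] := freeP _ (ltnW lti).
apply: extremal_step (extP (Ordinal lti)) (nEA _) _.
by rewrite -removal_take /= subnSK //; apply/IH/ltnW.
Qed.
End Chains.

(** * The toggle group of a power set *)

Section TogglePowerset.
Variables (T : finType) (E : {set T}).
Local Notation Omega := {X : {set T} | X \in powerset E}.
Local Notation G := (toggle_group E (powerset E)).

Let empty : Omega := exist (fun X : {set T} => X \in powerset E) set0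
  (etrans (powersetE _ _) (sub0set E)).

Lemma in_toggle_powerset e (X : Omega) x : e \in E ->
  (x \in val (toggle (powerset E) e X)) = (x \in val X) (+) (x == e).
Proof.
move=> eE; have := valP X; rewrite permE /= /toggle_set !powersetE => XE.
rewrite subUset sub1set eE XE (subset_trans (subD1set _ _) XE).
have [->|xe] := eqVneq x e; last first.
  by case: ifP => _; rewrite !inE ?(negPf xe) addbF.
by case: ifP => [/negPf->|/negbFE->]; rewrite !inE eqxx.
Qed.

(** Every element of the group is a translation by symmetric difference with its value at the empty
    set. Evaluation at the empty set is therefore injective, and the order of the group can be read
    off from its image. *)
Lemma toggle_powerset_addb g : g \in G -> forall (X : Omega) x,
  (x \in val (g X)) = (x \in val X) (+) (x \in val (g empty)).
Proof.
pose W := [set g : {perm Omega} |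
  [forall X, forall x, (x \in val (g X)) == (x \in val X) (+) (x \in val (g empty))]].
have WP (h : {perm Omega}) : reflect (forall (X : Omega) x, (x \in val (h X)) =
    (x \in val X) (+) (x \in val (h empty))) (h \in W).
  rewrite inE; apply: (iffP forallP) => [hP X x|hP X]; first exact/eqP/(forallP (hP X)).
  by apply/forallP => x; apply/eqP.
have gW : group_set W.
  apply/group_setP; split=> [|h1 h2 /WP h1P /WP h2P].
    by apply/WP => X x; rewrite !perm1 /= in_set0 addbF.
  by apply/WP => X x; rewrite !permM h2P h1P (h2P (h1 _)) addbA.
suff /subsetP sGW : G \subset Group gW by move=> /sGW /WP.
rewrite gen_subG; apply/subsetP => _ /imsetP[e eE ->]; apply/WP => X x.
by rewrite !in_toggle_powerset //= in_set0.
Qed.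

Lemma toggle_powerset_inj : {in G &, injective (fun g : {perm Omega} => g empty)}.
Proof.
move=> g h gG hG gh; apply/permP => X; apply/val_inj/setP => x.
by rewrite (toggle_powerset_addb gG) (toggle_powerset_addb hG) gh.
Qed.

Lemma toggle_powerset_onto : [set (g : {perm Omega}) empty | g in G] = setT.
Proof.
apply/setP => X; rewrite inE; have [n leXn] := ubnP #|val X|.
elim: n X leXn => // n IH X leXn; have [X0|[e eX]] := set_0Vmem (val X).
  apply/imsetP; exists 1; first exact: group1.
  by rewrite perm1; apply: val_inj; rewrite X0.
have eE : e \in E by apply: (subsetP _ e eX); rewrite -powersetE (valP X).
pose Y := toggle (powerset E) e X.
have tK : toggle (powerset E) e Y = X by rewrite /Y !permE toggle_funK.
have YE : val Y = val X :\ e.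
  apply/setP => x; rewrite in_toggle_powerset // !inE.
  by have [->|_] := eqVneq x e; rewrite ?eX // addbF.
have /imsetP[g gG Yg] : Y \in [set (g : {perm Omega}) empty | g in G].
  by apply: IH; rewrite YE; rewrite (cardsD1 e) eX in leXn.
apply/imsetP; exists (g * toggle (powerset E) e); last by rewrite permM -Yg tK.
by rewrite groupM // mem_gen // imset_f.
Qed.

Lemma toggle_powerset_abelem : 2.-abelem G /\ #|G| = (2 ^ #|E|)%N.
Proof.
split; last first.
  rewrite -(card_in_imset toggle_powerset_inj) toggle_powerset_onto cardsT.
  by rewrite card_sig -card_powerset.
have addE := toggle_powerset_addb.
apply/abelemP => //; split=> [|g gG]; last first.
  apply/permP => X; apply/val_inj/setP => x.
  by rewrite expgS expg1 permM perm1 (addE g) // (addE g gG X) addbK.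
apply/centsP => g gG h hG; apply/permP => X; apply/val_inj/setP => x.
rewrite !permM (addE h hG (g X)) (addE g gG X) (addE g gG (h X)) (addE h hG X).
exact: addbAC.
Qed.
End TogglePowerset.

(** Elementary abelian 2-groups of equal order are isomorphic, so these two facts identify the power
    of ['S_2] with a toggle group of a power set. *)
Lemma setXn_S2_abelem n :
  2.-abelem (setXn (fun _ : 'I_n => [set: 'S_2])) /\
  #|setXn (fun _ : 'I_n => [set: 'S_2])| = (2 ^ n)%N.
Proof.
have cardS2 : #|[set: 'S_2]| = 2 by rewrite cardsT card_Sn.
have /(abelemP (isT : prime 2))[cS2 S2sq] := prime_abelem (isT : prime 2) cardS2.
split; last by rewrite cardsXn (eq_bigr (fun=> 2)) // prod_nat_const card_ord.
apply/abelemP => //; split=> [|x _].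
  apply/centsP => x _ y _; apply/ffunP => i; rewrite !ffunE.
  by apply: (centsP cS2); rewrite inE.
apply/ffunP => i; rewrite expgS expg1 !ffunE.
by apply: S2sq; rewrite inE.
Qed.

(** * Permutations acting coordinatewise on a product *)

Section PermProd.
Variables (S S1 S2 : finType) (pr : S -> S1 * S2) (pair : S1 * S2 -> S).
Hypotheses (prK : cancel pr pair) (pairK : cancel pair pr).

Definition perm_prod_fun (g : {perm S1} * {perm S2}) x :=
  pair (g.1 (pr x).1, g.2 (pr x).2).

Lemma perm_prod_subproof g : injective (perm_prod_fun g).
Proof.
move=> x y /(can_inj pairK)[/perm_inj e1 /perm_inj e2].
apply: (can_inj prK).
by rewrite [pr x]surjective_pairing e1 e2 -surjective_pairing.
Qed.

Definition perm_prod g : {perm S} := perm (@perm_prod_subproof g).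

Lemma perm_prodE g x : perm_prod g x = pair (g.1 (pr x).1, g.2 (pr x).2).
Proof. by rewrite permE. Qed.

Lemma perm_prodM : {in setT &, {morph perm_prod : g h / g * h}}.
Proof.
by move=> g h _ _; apply/permP => x; rewrite permM !perm_prodE pairK /= !permM.
Qed.
Canonical perm_prod_morphism := Morphism perm_prodM.

(** The points [x1] and [x2] witness that both factors are inhabited; over an empty factor the other
    coordinate could not be recovered. *)
Lemma injm_perm_prod (x1 : S1) (x2 : S2) : 'injm perm_prod.
Proof.
apply/injmP => -[g1 g2] [h1 h2] _ _ gh.
have ghE y1 y2 : (g1 y1, g2 y2) = (h1 y1, h2 y2).
  apply: (can_inj pairK); have := congr1 (fun g : {perm S} => g (pair (y1, y2))) gh.
  by rewrite !perm_prodE pairK.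
by congr (_, _); apply/permP => y; [case: (ghE y x2) | case: (ghE x1 y)].
Qed.

Lemma gen_perm_prod_isog (A1 : {set {perm S1}}) (A2 : {set {perm S2}})
    (H : {group {perm S}}) : S1 -> S2 ->
  H :=: <<[set perm_prod (g, 1) | g in A1] :|: [set perm_prod (1, g) | g in A2]>> ->
  H \isog setX <<A1>> <<A2>>.
Proof.
move=> x1 x2 HE; have injp := injm_perm_prod x1 x2.
rewrite isog_sym; suff -> : H :=: perm_prod @* setX <<A1>> <<A2>>.
  by rewrite sub_isog ?subsetT.
apply/eqP; rewrite eqEsubset HE /= gen_subG subUset; apply/andP; split.
  apply/andP; split; apply/subsetP => _ /imsetP[g gA ->].
    by apply: mem_morphim; rewrite ?in_setT //; apply/setXP; rewrite mem_gen /=.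
  by apply: mem_morphim; rewrite ?in_setT //; apply/setXP; rewrite group1 mem_gen.
rewrite -setX_prod morphimMl ?subsetT // mul_subG //.
  rewrite -morphim_pairg1 !morphim_gen ?subsetT // genS //.
  apply/subsetP => _ /morphimP[_ _ /morphimP[g _ gA ->] ->].
  rewrite inE; apply/orP; left.
  by apply/imsetP; exists g.
rewrite -morphim_pair1g !morphim_gen ?subsetT // genS //.
apply/subsetP => _ /morphimP[_ _ /morphimP[g _ gA ->] ->].
rewrite inE; apply/orP; right.
by apply/imsetP; exists g.
Qed.
End PermProd.

(** * Toggle groups of product families *)

Section ToggleProd.
Variable T : finType.
Implicit Types (E X : {set T}) (L : {set {set T}}).

Definition toggle_prod E1 L1 E2 L2 L := forall X, (X \in L) =
  [&& X \subset E1 :|: E2, X :&: E1 \in L1 & X :&: E2 \in L2].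

Lemma toggle_prodC E1 L1 E2 L2 L :
  toggle_prod E1 L1 E2 L2 L -> toggle_prod E2 L2 E1 L1 L.
Proof. by move=> LE X; rewrite LE setUC [X in _ && X]andbC. Qed.

Lemma toggle_set_prod E1 L1 E2 L2 L e X : [disjoint E1 & E2] ->
  toggle_prod E1 L1 E2 L2 L -> e \in E1 -> X \in L ->
  toggle_set L e X = toggle_set L1 e (X :&: E1) :|: X :&: E2.
Proof.
move=> dE LE eE1; rewrite LE => /and3P[XE X1 X2].
have eNE2 : e \notin E2 by rewrite (disjointFr dE).
have XUE : X :&: E1 :|: X :&: E2 = X by rewrite -setIUr; apply/setIidPl.
rewrite /toggle_set inE eE1 andbT !LE subUset sub1set inE eE1 XE /=.
rewrite (subset_trans (subD1set _ _) XE) /=.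
have -> : (e |: X) :&: E1 = e |: X :&: E1.
  by apply/setP => x; rewrite !inE; case: eqP => [->|]; rewrite ?eE1.
have -> : (e |: X) :&: E2 = X :&: E2.
  by apply/setP => x; rewrite !inE; case: eqP => [->|]; rewrite ?(negPf eNE2) ?andbF.
have -> : (X :\ e) :&: E1 = (X :&: E1) :\ e by rewrite setIDAC.
have -> : (X :\ e) :&: E2 = X :&: E2.
  by apply/setP => x; rewrite !inE; case: eqP => [->|]; rewrite ?(negPf eNE2) ?andbF.
rewrite X2 !andbT; case: ifP => _; case: ifP => _ //.
  by rewrite -setUA XUE.
rewrite -{1}XUE setDUl; congr (_ :|: _); apply/setDidPl.
by rewrite disjoint_sym disjoints1 inE (negPf eNE2) andbF.
Qed.

(** A toggle at an element of [E1] changes only the trace on [E1], hence acts on the first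
    coordinate alone, and symmetrically for [E2]. The empty set inhabits both factors. *)
Lemma toggle_group_prod E1 L1 E2 L2 E L : E1 :|: E2 = E -> [disjoint E1 & E2] ->
  toggle_prod E1 L1 E2 L2 L -> set0 \in L1 -> set0 \in L2 ->
  L1 \subset powerset E1 -> L2 \subset powerset E2 ->
  toggle_group E L \isog setX (toggle_group E1 L1) (toggle_group E2 L2).
Proof.
move=> <- dE LE L1_0 L2_0 sL1 sL2.
have pr1P X : X \in L -> X :&: E1 \in L1 by rewrite LE => /and3P[].
have pr2P X : X \in L -> X :&: E2 \in L2 by rewrite LE => /and3P[].
have I12 X1 X2 : X1 \in L1 -> X2 \in L2 ->
    (X1 :|: X2) :&: E1 = X1 /\ (X1 :|: X2) :&: E2 = X2.
  move=> /(subsetP sL1)/[!powersetE] sX1 /(subsetP sL2)/[!powersetE] sX2.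
  rewrite !setIUl (setIidPl sX1) (setIidPl sX2); split.
    by rewrite (disjoint_setI0 (disjointWl sX2 _)) ?setU0 // disjoint_sym.
  by rewrite (disjoint_setI0 (disjointWl sX1 dE)) set0U.
have pairP X1 X2 : X1 \in L1 -> X2 \in L2 -> X1 :|: X2 \in L.
  move=> X1L X2L; have [i1 i2] := I12 _ _ X1L X2L; rewrite LE i1 i2 X1L X2L !andbT.
  by rewrite setUSS // -powersetE; [apply: (subsetP sL1)|apply: (subsetP sL2)].
pose O1 := {X : {set T} | X \in L1}; pose O2 := {X : {set T} | X \in L2}.
pose O := {X : {set T} | X \in L}.
pose pr (X : O) : O1 * O2 :=
  (Sub (val X :&: E1) (pr1P _ (valP X)), Sub (val X :&: E2) (pr2P _ (valP X))).
pose pair (X : O1 * O2) : O :=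
  Sub (val X.1 :|: val X.2) (pairP _ _ (valP X.1) (valP X.2)).
have prK : cancel pr pair.
  move=> X; apply: val_inj => /=; rewrite -setIUr; apply/setIidPl.
  by have := valP X; rewrite LE => /and3P[].
have pairK : cancel pair pr.
  move=> [[X1 X1L] [X2 X2L]]; have [i1 i2] := I12 _ _ X1L X2L.
  by congr (_, _); apply: val_inj.
apply: (gen_perm_prod_isog (prK := prK) (pairK := pairK)).
- by exists set0.
- by exists set0.
rewrite /=; congr <<_>>; rewrite imsetU -!imset_comp.
congr (_ :|: _); apply: eq_in_imset => e eE; apply/permP => X; apply/val_inj.
  rewrite /= perm_prodE !permE /= (toggle_set_prod dE LE eE) //.
  exact: valP X.
rewrite /= perm_prodE !permE /= setUC.
rewrite (toggle_set_prod _ (toggle_prodC LE) eE) // 1?disjoint_sym //.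
exact: valP X.
Qed.
End ToggleProd.

(** * Covers, and the decompositions of the toggle group of interval-closed sets *)

Lemma ex_maximal_rel (T : finType) (s : rel T) (p : pred T) x :
  irreflexive s -> transitive s -> p x ->
  exists y, [/\ (x == y) || s x y, p y & forall z, p z -> ~~ s y z].
Proof.
move=> s_irr s_trans; have [n] := ubnP #|[set z | p z && s x z]|.
elim: n x => // n IH x len px.
have [/exists_inP[y py xy]|] := boolP [exists y in p, s x y]; last first.
  by move/exists_inPn=> xP; exists x; rewrite eqxx; split=> // z pz; apply: xP.
have [|//|z [yz pz zP]] := IH y.
  rewrite -ltnS; apply: leq_trans len; rewrite ltnS.
  apply/proper_card/properP; split.
    by apply/subsetP => z; rewrite !inE => /andP[-> /(s_trans _ _ _ xy)].
  by exists y; rewrite !inE ?xy ?s_irr ?andbF // andbT.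
exists z; split=> //; case/orP: yz => [/eqP<-|/(s_trans _ _ _ xy)->].
  by rewrite xy orbT.
by rewrite orbT.
Qed.

Section IsogTIC.
Variables (d : Order.disp_t) (P : finPOrderType d).
Implicit Types (A B X : {set P}) (m x y z : P).
Local Open Scope order_scope.

Let leP A X := @ICP d P <=%O A X (or_introl erefl).

Lemma ex_coatom x m : x < m ->
  exists2 y, x <= y & covered [set: P] y m.
Proof.
move=> xm; have [||y [xy ym yP]] :=
    @ex_maximal_rel P <%O (fun y => y < m) x _ _ xm.
- exact: ltxx.
- exact: lt_trans.
exists y; first by rewrite le_eqVlt.
rewrite /covered !inE ym; apply/forall_inP => z _; apply/negP => /andP[yz zm].
by move: (yP z zm); rewrite yz.
Qed.

Lemma ex_atom x m : m < x ->
  exists2 y, y <= x & covered [set: P] m y.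
Proof.
move=> mx; have [||y [xy my yP]] :=
    @ex_maximal_rel P (fun x y => y < x) (fun y => m < y) x _ _ mx.
- exact: ltxx.
- by move=> y z w yz wy; apply: lt_trans yz.
exists y; first by rewrite le_eqVlt eq_sym.
rewrite /covered !inE my; apply/forall_inP => z _; apply/negP => /andP[mz zy].
by move: (yP z mz); rewrite zy.
Qed.

(** Covers are traded for the order: anything strictly on the [r]-side of [m] lies on that side of
    some [y] adjacent to [m] by a cover. Such a [y] is extremal, so both [x] and [z] equal it. *)
Lemma extremal_atomicP m : extremal_atomic [set: P] m ->
  exists2 r : rel P, r = <=%O \/ r = >=%O &
    (forall z, r m z -> z = m) /\
    forall x z, r x z -> r z m -> z = x \/ z = m.
Proof.
case/orP => /andP[/[dup] mm /andP[_ /forall_inP mP] /forall_inP cP].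
  exists <=%O; first by left.
  have {}mP z : m <= z -> z = m by move=> mz; apply: (maximalE mm).2.
  split=> // x z xz zm; have [->|zNm] := eqVneq z m; [by right | left].
  have /ex_coatom[y zy ym] : z < m by rewrite lt_neqAle zNm.
  have [_ yP] := minimalE (implyP (cP y (in_setT y)) ym).
  by rewrite (yP z) // (yP x) // (le_trans xz).
exists >=%O; first by right.
have {}mP z : z <= m -> z = m by move=> mz; apply: (minimalE mm).2.
split=> // x z xz zm; have [->|zNm] := eqVneq z m; [by right | left].
have /ex_atom[y zy ym] : m < z by rewrite lt_neqAle eq_sym zNm.
have [_ yP] := maximalE (implyP (cP y (in_setT y)) ym).
by rewrite (yP z) // (yP x) // (le_trans zy).
Qed.

Lemma IC_set0 A : set0 \in IC A.
Proof. by apply/leP; rewrite sub0set; split=> // x y z; rewrite inE. Qed.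

Lemma IC_sub_powerset A : IC A \subset powerset A.
Proof. by apply/subsetP => X /leP[]; rewrite powersetE. Qed.

Lemma IC_setI A X : X \in IC [set: P] -> X :&: A \in IC A.
Proof.
move=> /leP[_ cX]; apply/leP; split=> [|x y z]; first exact: subsetIr.
move=> /setIP[xX _] /setIP[yX _] zA xz zy; rewrite inE zA andbT.
by apply: (cX x y); rewrite ?inE.
Qed.

Lemma IC_powerset A :
  (forall x y z, x \in A -> y \in A -> z \in A -> x <= z -> z <= y -> z = x \/ z = y) ->
  IC A = powerset A.
Proof.
move=> AP; apply/setP => X; rewrite powersetE; apply/leP/idP => [[]//|XA].
split=> // x y z xX yX zA xz zy.
by have [->|->] := AP x y z (subsetP XA x xX) (subsetP XA y yX) zA xz zy.
Qed.

(** Only gluing has to be assumed, since traces of interval-closed sets are always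
    interval-closed. *)
Lemma TIC_isog_setX A B : A :|: B = [set: P] -> [disjoint A & B] ->
  (forall X, X :&: A \in IC A -> X :&: B \in IC B -> X \in IC [set: P]) ->
  TIC [set: P] \isog setX (TIC A) (TIC B).
Proof.
move=> AB dAB ICAB.
apply: (toggle_group_prod AB dAB); rewrite ?IC_set0 ?IC_sub_powerset // => X.
rewrite AB subsetT /=; apply/idP/andP => [XI|[]]; last exact: ICAB.
by split; apply: IC_setI.
Qed.

Lemma TIC_disjoint_union A B : is_disjoint_union A B ->
  TIC [set: P] \isog setX (TIC A) (TIC B).
Proof.
case=> AB AB0 incAB; apply: TIC_isog_setX => //; first by rewrite -setI_eq0 AB0.
move=> X /leP[_ cA] /leP[_ cB]; apply/leP; split; first exact: subsetT.
have incBA x y : x \in B -> y \in A -> x >< y.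
  by move=> xB yA; rewrite comparable_sym incAB.
have inAB x : (x \in A) || (x \in B) by rewrite -in_setU AB inE.
move=> x y z xX yX _ xz zy.
have xz' : x >=< z by rewrite /Order.comparable xz.
have zy' : z >=< y by rewrite /Order.comparable zy.
case/orP: (inAB z) => zI.
  case/orP: (inAB x) => xI; last by move: (incBA x z xI zI); rewrite xz'.
  case/orP: (inAB y) => yI; last by move: (incAB z y zI yI); rewrite zy'.
  have /setIP[] // : z \in X :&: A.
    by apply: (cA x y); rewrite // inE ?xX ?yX.
case/orP: (inAB x) => xI; first by move: (incAB x z xI zI); rewrite xz'.
case/orP: (inAB y) => yI; first by move: (incBA z y zI yI); rewrite zy'.
have /setIP[] // : z \in X :&: B.
  by apply: (cB x y); rewrite // inE ?xX ?yX.
Qed.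

(** An interval involving [m] has no other element strictly between its ends, and [m] itself is
    never interior. So closure is decided on the complement of [m]. *)
Lemma TIC_extremal_atomic m : extremal_atomic [set: P] m ->
  TIC [set: P] \isog setX (TIC ([set: P] :\ m)) (TIC [set m]).
Proof.
move=> /extremal_atomicP[r rE [mP cP]]; apply: TIC_isog_setX.
- by rewrite setUC setD1K ?inE.
- by rewrite disjoint_sym disjoints1 !inE eqxx.
move=> X /(ICP _ _ rE)[_ cX] _; apply/(ICP _ _ rE); split; first exact: subsetT.
move=> x y z xX yX _ xz zy.
have [zm|zm] := eqVneq z m; first by rewrite zm -(mP y) // -zm.
have [ym|ym] := eqVneq y m.
  rewrite ym in zy.
  by have [->//|/eqP] := cP x z xz zy; rewrite (negPf zm).
have [xm|xm] := eqVneq x m; first by rewrite xm in xz; rewrite (mP z xz) eqxx in zm.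
by have := cX x y z; rewrite !inE xX yX xm ym zm => /(_ isT isT isT xz zy)/andP[].
Qed.

Lemma TIC_set1 m : TIC [set m] \isog [set: 'S_2].
Proof.
have ICm : IC [set m] = powerset [set m].
  by apply: IC_powerset => x y z /set1P-> _ /set1P->; left.
have [abT cardT] := toggle_powerset_abelem [set m]; rewrite cards1 in cardT.
have cS2 : #|[set: 'S_2]| = 2 by rewrite cardsT card_Sn.
rewrite /TIC ICm (isog_abelem_card _ abT) cardT cS2 eqxx andbT.
exact: prime_abelem cS2.
Qed.

(** Descending through covers shows that [rk] is strictly increasing, so a three-chain would take
    three rank values. *)
Lemma two_ranks_chain (rk : P -> nat) x y z :
  (forall x y, covered [set: P] x y -> rk y = (rk x).+1) ->
  size (undup (codom rk)) = 2 -> x < z -> z < y -> False.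
Proof.
move=> rkP rk2.
have rk_lt u v : u < v -> (rk u < rk v)%N.
  have [n] := ubnP (rk v); elim: n v => // n IH v lev /ex_coatom[w uw wv].
  have rkv := rkP _ _ wv; rewrite rkv ltnS in lev *.
  by move: uw; rewrite le_eqVlt => /predU1P[->//|/(IH _ lev)/ltnW].
move=> /rk_lt xz /rk_lt zy.
suff : (size [:: rk x; rk z; rk y] <= size (undup (codom rk)))%N by rewrite rk2.
apply: uniq_leq_size => [|n].
  by rewrite /= !inE negb_or !ltn_eqF // (ltn_trans xz).
by rewrite mem_undup !inE => /or3P[] /eqP->; apply: codom_f.
Qed.

(** Without three-chains every subset is interval-closed, so the power set computation applies at
    once to all of [P]. *)
Lemma TIC_two_ranks : two_ranks P ->
  TIC [set: P] \isog setXn (fun _ : 'I_#|P| => [set: 'S_2]).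
Proof.
move=> [rk [rkP rk2]].
have ICP : IC [set: P] = powerset [set: P].
  apply: IC_powerset => x y z _ _ _; rewrite !le_eqVlt.
  case/predU1P=> [->|xz]; first by left.
  case/predU1P=> [->|zy]; first by right.
  by case: (two_ranks_chain rkP rk2 xz zy).
have [abT cardT] := toggle_powerset_abelem [set: P].
have [abS cardS] := setXn_S2_abelem #|P|.
rewrite /TIC ICP (isog_abelem_card _ abT) abS cardT.
by apply/eqP; rewrite cardsT; apply: cardS.
Qed.
End IsogTIC.

(** * Assembly of the isomorphisms and the alternating case *)

Lemma isog_setXr (gT rT1 rT2 : finGroupType) (G : {group gT})
    (H1 : {group rT1}) (H2 : {group rT2}) :
  H1 \isog H2 -> setX G H1 \isog setX G H2.
Proof.
move=> H12; apply: (isog_dprod (setX_dprod G H1) (setX_dprod G H2)).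
  by apply: isog_trans (isog_setX1 _ _); rewrite isog_sym isog_setX1.
apply: isog_trans (isog_set1X _ _); apply: isog_trans H12.
by rewrite isog_sym isog_set1X.
Qed.

Theorem corollary3p20 (d : Order.disp_t) (P : finPOrderType d) :
  (forall P1 P2 : {set P}, is_disjoint_union P1 P2 ->
     TIC [set: P] \isog setX (TIC P1) (TIC P2)) /\
  (~ (exists P1 P2 : {set P},
        [/\ P1 != set0, P2 != set0 & is_disjoint_union P1 P2]) ->
   [/\ (forall m : P, extremal_atomic [set: P] m ->
          TIC [set: P] \isog setX (TIC ([set: P] :\ m)) (TIC [set m]) /\
          setX (TIC ([set: P] :\ m)) (TIC [set m])
            \isog setX (TIC ([set: P] :\ m)) [set: 'S_2]),
       (two_ranks P ->
          TIC [set: P] \isog setXn (fun _ : 'I_#|P| => [set: 'S_2]))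
     & (strongly_extremal_atomic_free P ->
          toggle_alternating [set: P] (IC [set: P]))]).
Proof.
split=> [P1 P2|_]; first exact: TIC_disjoint_union.
split=> [m mEA||/large_alternating_strongly_extremal_atomic_free[_]//].
  by split; [apply: TIC_extremal_atomic | apply/isog_setXr/TIC_set1].
exact: TIC_two_ranks.
Qed.
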